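(* Let $X$ be a zero-dimensional space and let $Z$ be a zero-set of $\beta_0X$ such that $Z\cap X=\emptyset$. Then $Z$ (with the subspace topology) is a Parovičenko space.
   Context: A zero-dimensional space is a Hausdorff topological space with a base of clopen sets. The Banaschewski compactification $\beta_0X$ of a zero-dimensional space $X$ is the (unique up to homeomorphism) compact zero-dimensional space containing $X$ as a dense subspace such that every continuous function $X\to\{0,1\}$ extends continuously to $\beta_0X$. A zero-set of a space $Y$ is a set of the form $\{y\in Y:f(y)=0\}$ with $f:Y\to\mathbb{R}$ continuous. A compact zero-dimensional space $Y$ is called a Parovičenko space if: (a) $Y$ has no isolated points; (b) nonempty $G_\delta$-subsets of $Y$ have nonempty interior; (c) $Y$ is an $F$-space, i.e. for each continuous $f:Y\to\mathbb{R}$ the sets $\mathrm{pos}(f)=\{y: f(y)>0\}$ and $\mathrm{neg}(f)=\{y: f(y)<0\}$ are completely separated in $Y$. *)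

(* Defs.v *)
From HB Require Import structures.
From mathcomp Require Import all_boot all_order all_algebra.
From mathcomp Require Import all_classical all_reals all_analysis.
From mathcomp Require Import borel_hierarchy.

Set Implicit Arguments.
Unset Strict Implicit.
Unset Printing Implicit Defensive.

Import Order.TTheory GRing.Theory Num.Theory.
Import numFieldNormedType.Exports.

Local Open Scope classical_set_scope.
Local Open Scope ring_scope.

(* Not the library's [zero_dimensional], which only asks that distinct points
   be separated by a clopen set. *)
Definition zero_dimensional_space (T : topologicalType) : Prop :=
  hausdorff_space T /\ exists2 B : set (set T), basis B & B `<=` clopen.

Definition topological_embedding (X Y : topologicalType) (e : X -> Y) : Prop :=
  injective e /\
  forall A : set X, open A <-> exists2 B : set Y, open B & e @^-1` B = A.

(* [bX], with [X] embedded by [e], is the Banaschewski compactification of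
   [X], which is determined up to homeomorphism over [X]; [bool] carries the
   discrete topology. *)
Definition banaschewski (X bX : topologicalType) (e : X -> bX) : Prop :=
  [/\ compact [set: bX], zero_dimensional_space bX,
      topological_embedding e, dense (range e) &
      forall g : X -> bool, continuous g ->
        exists2 h : bX -> bool, continuous h & h \o e = g].

Definition zero_set (R : realType) (Y : topologicalType) (Z : set Y) : Prop :=
  exists2 f : Y -> R, continuous f & Z = [set y | f y = 0].

Definition completely_separated (R : realType) (Y : topologicalType)
    (A B : set Y) : Prop :=
  exists g : Y -> R, [/\ continuous g, range g `<=` `[0, 1],
    g @` A `<=` [set 0] & g @` B `<=` [set 1]].

Definition F_space (R : realType) (Y : topologicalType) : Prop :=
  forall f : Y -> R, continuous f ->
    completely_separated R [set y | 0 < f y] [set y | f y < 0].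

Definition parovicenko (R : realType) (Y : topologicalType) : Prop :=
  [/\ compact [set: Y] /\ zero_dimensional_space Y,
      isolated [set: Y] = set0,
      (forall G : set Y, Gdelta G -> G !=set0 -> G° !=set0) &
      F_space R Y].

(* Main.v *)
Require Import Defs.
From mathcomp Require Import all_boot all_order all_algebra.
From mathcomp Require Import all_classical all_reals all_analysis.
Import Order.TTheory GRing.Theory Num.Theory.
Import numFieldNormedType.Exports.
Local Open Scope classical_set_scope.

(** Write [K] for the compactification [bX].  By compactness, the zero-set [Z]
is the intersection of a decreasing sequence of clopen sets [V n] of [K].  The
whole argument rests on two consequences of the hypotheses.

- [Z] has empty interior, since [X] is dense in [K] and misses [Z].

- If the [C n] are clopen and [C n] lies in [V n], then the closure of their
  union is clopen ([banaschewski_shrinking_closures]).  Away from [Z] the family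
  is locally finite, as a point outside [V N] can only be in [C n] for [n < N];
  so the union has a clopen trace on [X], whose characteristic function extends
  to [K], and by density the extension is the characteristic function of the
  closure.

Such closures are the source of all the clopen subsets of [Z] that are needed.
If the [C n] are nonempty, compactness forces the closure to meet [Z]
([closed_trap_meets]), and if moreover each [C n] misses [Z], then finitely many
of the [C n] have no influence on the part of the closure in [Z].

- No isolated points ([clopen_splits]): inside a clopen set [C] that meets [Z],
  the emptiness of the interior of [Z] yields infinitely many disjoint nonempty
  clopen pieces that shrink to [Z].  The closures of the even and of the odd
  pieces cut the trace of [C] on [Z] into two nonempty parts.

- Interiors of G-delta sets ([clopen_inside_bigcap]): around a point of the set,
  choose clopen sets [C n] whose traces on [Z] lie in the given open sets, and
  a nonempty clopen piece of [C 0 `&` ... `&` C n `&` V n] that misses [Z].  The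
  closure of the union of the pieces meets [Z] inside every [C n].

- F-space ([clopen_separates_sequences]): the sets where a function on [Z] is
  positive, respectively negative, are traces of unions of clopen sets [A n],
  respectively [B n], of [K].  Although [A m] and [B n] may meet outside [Z],
  they no longer do after intersection with suitable neighbourhoods [U n] of [Z]
  that shrink to [Z]; the closure of the union of the [A n `&` U n] is then a
  clopen set that contains the first set and misses the second. *)

(** * Clopen sets in compact zero-dimensional spaces *)

Lemma closure_subW {T : topologicalType} (A B : set T) :
  closed B -> A `<=` B -> closure A `<=` B.
Proof. by move=> cB AB; rewrite [B](closure_id B).1//; exact: closureS. Qed.

Lemma clopen_setD {T : topologicalType} (A B : set T) :
  clopen A -> clopen B -> clopen (A `\` B).
Proof.
by move=> ? ?; rewrite setDE; apply: clopenI => //; exact: (clopenC set0).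
Qed.

Lemma clopen_bigcup_fin {T : topologicalType} (C : nat -> set T) (n : nat) :
  (forall i, clopen (C i)) -> clopen (\bigcup_(i < n) C i).
Proof.
move=> cC; split; first by apply: bigcup_open => i _; case: (cC i).
by apply: closed_bigcup => [|i _]; [exact: finite_II|case: (cC i)].
Qed.

Lemma continuous_clopen_if {T S : topologicalType} (A : set T) (a b : S) :
  clopen A -> continuous (fun x => if x \in A then a else b).
Proof.
move=> [oA cA] x; apply: cvg_near_cst; have [Ax|nAx] := boolP (x \in A).
  have : nbhs x A by apply: open_nbhs_nbhs; split => //; rewrite -in_setE.
  by apply: filterS => y Ay; rewrite mem_set.
have : nbhs x (~` A).
  apply: open_nbhs_nbhs; split; first exact: closed_openC.
  by move=> /mem_set; exact/negP.
by apply: filterS => y Ay; rewrite memNset.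
Qed.

Lemma dense_subset_closed {T : topologicalType} (D U F : set T) :
  dense D -> open U -> closed F -> U `&` D `<=` F -> U `<=` F.
Proof.
move=> dD oU cF UDF x Ux; apply: contrapT => nFx.
have [||y [[Uy nFy] Dy]] := dD (U `\` F); first by exists x.
  by rewrite setDE; apply: openI => //; exact: closed_openC.
by apply: nFy; exact: UDF.
Qed.

(** The clopen subsets of [U] are directed under inclusion, so the finitely many
of them that cover the compact set [F] can be merged into one.  The proof uses
the filter of their up-sets, which lets compactness produce a single clopen set
directly. *)
Lemma clopen_between {T : topologicalType} (F U : set T) :
  compact [set: T] -> zero_dimensional_space T -> closed F -> open U ->
  F `<=` U -> exists C, [/\ clopen C, F `<=` C & C `<=` U].
Proof.
move=> cT [_ [B [_ nbB] Bcl]] cF oU FU.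
pose P (C : set T) := clopen C /\ C `<=` U.
pose above (C : set T) := [set D | C `<=` D].
have FP : Filter (filter_from P above).
  apply: filter_from_filter; first by exists set0; split=> //; exact: clopen0.
  move=> C D [cC CU] [cD DU]; exists (C `|` D).
    by split; [exact: clopenU|rewrite subUset].
  move=> E CDE; split; apply: subset_trans CDE.
    exact: subsetUl.
  exact: subsetUr.
have /compact_near_coveringP/(_ _ _ (fun C x => C x) FP)[] :=
    subclosed_compact cF cT (@subsetT _ F).
  move=> x Fx; have [|C [BC Cx] CU] := nbB x U.
    by apply: open_nbhs_nbhs; split => //; exact: FU.
  have cC := Bcl _ BC.
  exists (C, above C); last by move=> [y D] /= [Cy]; exact.
  split; last by exists C.
  by apply: open_nbhs_nbhs; split => //; case: cC.
by move=> C [cC CU] /(_ C (@subset_refl _ C)) FC; exists C.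
Qed.

Lemma nested_closed_nonempty {T : topologicalType} (F : nat -> set T) :
  compact [set: T] -> (forall n, closed (F n)) -> (forall n, F n !=set0) ->
  (forall m n, (m <= n)%N -> F n `<=` F m) -> \bigcap_n F n !=set0.
Proof.
move=> /compact_near_coveringP cT cF F0 Fdecr; apply: contrapT => noF.
have [] := cT nat \oo (fun n x => ~ F n x).
  move=> x _; have [N nFx] : exists N, ~ F N x.
    by apply/existsNP => FNx; apply: noF; exists x => n _.
  exists (~` F N, [set n | (N <= n)%N]).
    split => /=; last exact: nbhs_infty_ge.
    by apply: open_nbhs_nbhs; split => //; exact: closed_openC.
  by move=> [y n] /= [nFy Nn] /(Fdecr _ _ Nn).
move=> N _ /(_ N (leqnn N)) FN0.
by have [x FNx] := F0 N; exact: FN0 FNx.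
Qed.

(** * Clopen sets shrinking to a zero-set *)

Definition clopen_filtration {T : topologicalType} (Z : set T)
    (V : nat -> set T) :=
  [/\ forall n, clopen (V n), forall m n, (m <= n)%N -> V n `<=` V m
    & \bigcap_n V n = Z].

Lemma decr_intersections {T : topologicalType} (G : nat -> set T) :
  (forall n, clopen (G n)) ->
  clopen_filtration (\bigcap_n G n) (fun n => \bigcap_(i < n.+1) G i).
Proof.
move=> cG; split=> [n|m n mn x Gx i /= im|].
- rewrite -[X in clopen X]setCK setC_bigcap; apply: (clopenC set0).
  by apply: (clopen_bigcup_fin (fun i => ~` G i)) => i; exact: (clopenC set0).
- by apply: Gx => /=; exact: leq_trans mn.
- apply/seteqP; split=> [x Gx n _|x Gx n _ i _]; last exact: Gx.
  by apply: (Gx n I) => /=.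
Qed.

(** Clopen sets interpolated between the zero-set and the open sets where
[`|f| < n.+1%:R^-1] intersect in the zero-set; finite intersections make the
sequence decrease. *)
Lemma zero_set_clopen_filtration {R : realType} {T : topologicalType}
    (Z : set T) :
  compact [set: T] -> zero_dimensional_space T -> zero_set R Z ->
  exists V, clopen_filtration Z V.
Proof.
move=> cT zT [f cf ->].
have cZ : closed [set y | f y = 0%R].
  by apply: (preimage_closed _ (@closed_eq R 0%R)) => y _; exact: cf.
have G_ex n : exists C, [/\ clopen C, [set y | f y = 0%R] `<=` C &
    C `<=` [set y | (`|f y| < n.+1%:R^-1)%R]].
  apply: clopen_between => //; last by move=> y /= ->; rewrite normr0 invr_gt0.
  have -> : [set y | (`|f y| < n.+1%:R^-1)%R] =
      (fun y => `|f y|)%R @^-1` [set r | (r < n.+1%:R^-1)%R] by [].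
  apply: open_comp; last exact: open_lt.
  by move=> y _; apply: (continuous_comp (cf y)); apply: norm_continuous.
have [G GP] := choice G_ex.
exists (fun n => \bigcap_(i < n.+1) G i).
rewrite (_ : [set y | _] = \bigcap_n G n).
  by apply: decr_intersections => n; case: (GP n).
apply/seteqP; split=> [y fy n _|y Gy]; first by case: (GP n) => _ + _; exact.
apply/eqP; rewrite -normr_le0 leNgt; apply/negP => fy0.
have [n fyn] : exists n : nat, (n.+1%:R^-1 < `|f y|)%R.
  by have [n] := ltr_add_invr fy0; rewrite add0r => ?; exists n.
case: (GP n) => _ _ /(_ y (Gy n I)) /= /lt_trans /(_ fyn).
by rewrite ltxx.
Qed.

(** The only trace of the extension property of the compactification that the
rest of the argument retains. *)
Definition shrinking_closures_clopen {T : topologicalType} (V : nat -> set T) :=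
  forall C : nat -> set T, (forall n, clopen (C n)) ->
    (forall n, C n `<=` V n) -> clopen (closure (\bigcup_n C n)).

(** Local finiteness away from [Z]: on the complement of [V N] only the finitely
many [C i] with [i < N] occur, so the union is closed relative to the complement
of [Z]. *)
Lemma bigcup_shrinking_closed {T : topologicalType} (Z : set T)
    (V C : nat -> set T) :
  clopen_filtration Z V -> (forall n, clopen (C n)) ->
  (forall n, C n `<=` V n) ->
  exists2 U, open U & U `\` Z = ~` (\bigcup_n C n) `\` Z.
Proof.
move=> [cV Vdecr VZ] cC CV.
exists (\bigcup_N (~` V N `\` \bigcup_(i < N) C i)).
  apply: bigcup_open => N _.
  have cVN : clopen (~` V N) by exact: (clopenC set0).
  by case: (clopen_setD _ _ cVN (clopen_bigcup_fin C N cC)).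
apply/seteqP; split=> x [].
  move=> [N _ [nVx nCx]] Zx; split => // -[n _ Cnx]; have [nN|Nn] := ltnP n N.
    by apply: nCx; exists n.
  by apply: nVx; apply: (Vdecr _ _ Nn); exact: CV.
move=> nCx Zx; split => //; have [N nVx] : exists N, ~ V N x.
  by apply/existsNP => Vx; apply: Zx; rewrite -VZ => n _.
by exists N => //; split => // -[i _ Cix]; apply: nCx; exists i.
Qed.

(** The trace of the union on [X] is clopen, so its characteristic function
extends to a continuous [h] on [bX].  The clopen set where [h] is true and the
closure of the union have the same trace on the dense set [X], hence agree. *)
Lemma banaschewski_shrinking_closures {X bX : topologicalType} (e : X -> bX)
    (Z : set bX) (V : nat -> set bX) :
  banaschewski e -> Z `&` range e = set0 -> clopen_filtration Z V ->
  shrinking_closures_clopen V.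
Proof.
move=> [_ _ [_ embE] dense_e ext_e] Z0 fV C cC CV.
have ce : continuous e by apply/continuousP => A oA; apply/embE; exists A.
have Ze x : ~ Z (e x) by move=> Zx; have : set0 (e x) by rewrite -Z0; split.
have cA : clopen (e @^-1` (\bigcup_n C n)).
  split.
    by move/continuousP: ce; apply; apply: bigcup_open => n _; case: (cC n).
  have [U oU UE] := bigcup_shrinking_closed Z V C fV cC CV.
  rewrite -openC (_ : ~` _ = e @^-1` U); first by move/continuousP: ce; apply.
  apply/seteqP; split=> x Ux.
    by have [] : (U `\` Z) (e x) by rewrite UE; split => //; exact: Ze.
  have [] // : (~` (\bigcup_n C n) `\` Z) (e x).
  by rewrite -UE; split => //; exact: Ze.
have [h ch hE] := ext_e _ (continuous_clopen_if _ true false cA).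
have cW : clopen (h @^-1` [set true]).
  apply: preimage_clopen => //.
  by split; [exact: discrete_open|exact: discrete_closed].
have WE x : h (e x) = true <-> (\bigcup_n C n) (e x).
  rewrite -[h (e x)]/((h \o e) x) hE; case: ifPn => [|/negP nx].
    by rewrite inE.
  by split => // Cx; exfalso; apply: nx; rewrite inE.
suff -> : closure (\bigcup_n C n) = h @^-1` [set true] by [].
have oC : open (\bigcup_n C n) by apply: bigcup_open => n _; case: (cC n).
case: cW => oW cW; apply/seteqP; split.
  apply: closure_subW => //.
  apply: (dense_subset_closed _ _ _ dense_e) => // y [Cy [x _ exy]].
  by rewrite -exy in Cy *; exact: (WE x).2.
apply: (dense_subset_closed _ _ _ dense_e) => //; first exact: closed_closure.
move=> y [Wy [x _ exy]]; rewrite -exy in Wy *.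
by apply: subset_closure; exact: (WE x).1.
Qed.

(** * Clopen traces on a nowhere dense intersection *)

(** The closed sets [W `&` V n] decrease and are nonempty because of [C n];
their intersection is [Z `&` W]. *)
Lemma closed_trap_meets {T : topologicalType} (Z W : set T)
    (V C : nat -> set T) :
  compact [set: T] -> clopen_filtration Z V -> closed W ->
  (forall n, C n !=set0) -> (forall n, C n `<=` V n) ->
  (forall n, C n `<=` W) -> Z `&` W !=set0.
Proof.
move=> cT [cV Vdecr VZ] cW C0 CV CW.
have [||m n mn x [Wx Vx]|x Vx] :=
    nested_closed_nonempty (fun n => W `&` V n) cT.
- by move=> n; apply: closedI => //; case: (cV n).
- move=> n; have [x Cx] := C0 n; exists x; split.
    exact: (CW n).
  exact: (CV n).
- by split => //; exact: Vdecr mn _ Vx.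
- exists x; split; last by case: (Vx 0 I).
  by rewrite -VZ => n _; case: (Vx n I).
Qed.

(** The open set [O `&` V n] contains a point of [Z], so it cannot be contained
in [Z]: some point of it has already left the filtration at stage [m]. *)
Lemma filtration_escape {T : topologicalType} (Z O : set T)
    (V : nat -> set T) (n : nat) :
  clopen_filtration Z V -> Z° = set0 -> open O -> Z `&` O !=set0 ->
  exists m, (n < m)%N /\ (O `&` V n) `\` V m !=set0.
Proof.
move=> [cV Vdecr VZ] Z0 oO [p [Zp Op]].
have [x [[Ox Vx] nZx]] : (O `&` V n) `\` Z !=set0.
  apply: contrapT => OVZ; suff : set0 p by [].
  rewrite -Z0 /interior /= nbhsE; exists (O `&` V n).
    split; first by apply: openI => //; case: (cV n).
    by split => //; move: Zp; rewrite -VZ; exact.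
  by move=> x OVx; apply: contrapT => nZx; apply: OVZ; exists x.
have [m nVx] : exists m, ~ V m x.
  by apply/existsNP => Vmx; apply: nZx; rewrite -VZ => k _.
exists m; split; last by exists x.
by rewrite ltnNge; apply/negP => /Vdecr; apply: contra_not nVx; exact.
Qed.

(** Along a subsequence [h] of indices, the layers
[C `&` V (h n) `\` V (h n.+1)] are nonempty and pairwise disjoint.  The odd
layers are open, so they miss the closure [W] of the union of the even ones.
As [W] is clopen, [C `&` W] and [C `\` W] are closed, and each contains one of
the two families, which accumulates on [Z]. *)
Lemma clopen_splits {T : topologicalType} (Z C : set T) (V : nat -> set T) :
  compact [set: T] -> clopen_filtration Z V -> Z° = set0 ->
  shrinking_closures_clopen V -> clopen C -> Z `&` C !=set0 ->
  exists W, [/\ clopen W, Z `&` (C `&` W) !=set0 & Z `&` (C `\` W) !=set0].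
Proof.
move=> cT fV Z0 sV cC ZC; have [cV Vdecr _] := fV.
have [g gP] := choice (fun n => filtration_escape _ _ _ n fV Z0 cC.1 ZC).
pose h n := iter n g 0.
have hS n : (h n < h n.+1)%N by case: (gP (h n)).
have h_mono m n : (m <= n)%N -> (h m <= h n)%N.
  move: m n; apply: (@homo_leq _ h leq) => [k|k i j|k].
  - exact: leqnn.
  - exact: leq_trans.
  - exact: ltnW.
have h_ge n : (n <= h n)%N by elim: n => // n IHn; exact: leq_ltn_trans (hS n).
pose E n := (C `&` V (h n)) `\` V (h n.+1).
have E0 n : E n !=set0 by case: (gP (h n)).
have cE n : clopen (E n) by apply: clopen_setD => //; exact: clopenI.
have EV n k : (k <= n)%N -> E n `<=` V k.
  by move=> kn x [[_ Vx] _]; apply: Vdecr Vx; exact: leq_trans (h_ge n).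
(* For [m < n] the layer [E n] lies in [V (h n)], which [E m] avoids. *)
have Edisj m n : (m < n)%N -> E m `&` E n = set0.
  move=> mn; apply/seteqP; split => // x [[_ nVx] [[_ Vx] _]]; apply: nVx.
  by apply: Vdecr Vx; exact: h_mono.
pose W := closure (\bigcup_n E n.*2).
have cW : clopen W.
  by apply: sV => n //; apply: EV; rewrite -addnn leq_addr.
have WE n : W `<=` ~` E n.*2.+1.
  apply: closure_subW; first by apply: open_closedC; case: (cE n.*2.+1).
  move=> x [m _ Emx] Enx; case: (ltngtP m.*2 n.*2.+1) => mn.
  - by have : set0 x by rewrite -(Edisj _ _ mn).
  - by have : set0 x by rewrite -(Edisj _ _ mn).
  - by have := congr1 odd mn; rewrite /= !odd_double.
exists W; split => //.
- apply: (closed_trap_meets _ _ V (fun n => E n.*2)) => // [|n|n].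
  + by apply: closedI; [case: cC|case: cW].
  + by apply: EV; rewrite -addnn leq_addr.
  + by move=> x Ex; split; [case: Ex => [[]]|apply: subset_closure; exists n].
- apply: (closed_trap_meets _ _ V (fun n => E n.*2.+1)) => // [|n|n].
  + by case: (clopen_setD _ _ cC cW).
  + by apply: EV; rewrite -addnn -addnS leq_addr.
  + by move=> x Ex; split=> [|/(WE n)]; [case: Ex => [[]]|exact].
Qed.

(** The pieces [E n] miss [Z], so for each [n] the first [n] of them can be
discarded when looking at the closure of their union inside [Z]; the remaining
ones all lie in the closed set [C n]. *)
Lemma clopen_inside_bigcap {T : topologicalType} (Z : set T)
    (V C : nat -> set T) :
  compact [set: T] -> clopen_filtration Z V -> Z° = set0 ->
  shrinking_closures_clopen V -> (forall n, clopen (C n)) ->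
  Z `&` \bigcap_n C n !=set0 ->
  exists W, [/\ clopen W, Z `&` W !=set0 & Z `&` W `<=` \bigcap_n C n].
Proof.
move=> cT fV Z0 sV cC [p [Zp Cp]]; have [cV Vdecr VZ] := fV.
pose D n := \bigcap_(i < n.+1) C i.
have [cD Ddecr DC] : clopen_filtration (\bigcap_n C n) D.
  exact: decr_intersections.
have ZD n : Z `&` D n !=set0 by exists p; split => // i _; exact: (Cp i I).
have [m mP] :=
  choice (fun n => filtration_escape _ _ _ n fV Z0 (cD n).1 (ZD n)).
pose E n := (D n `&` V n) `\` V (m n).
have cE n : clopen (E n) by apply: clopen_setD => //; exact: clopenI.
have EV n : E n `<=` V n by move=> x [[]].
have cW := sV E cE EV.
exists (closure (\bigcup_n E n)); split => //.
  apply: (closed_trap_meets _ _ V E) => // [|n|n x Ex]; first by case: cW.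
    by case: (mP n).
  by apply: subset_closure; exists n.
move=> z [Zz Wz]; rewrite -DC => n _.
have : (D n `|` \bigcup_(i < n) E i) z.
  move: z {Zz} Wz; apply: closure_subW.
    by case: (clopenU (cD n) (clopen_bigcup_fin E n cE)).
  move=> x [i _ Eix]; have [ni|ni] := leqP n i; last by right; exists i.
  by left; apply: Ddecr ni _ _; case: Eix => [[]].
case=> // -[i _ [_ []]]; by move: Zz; rewrite -VZ; exact.
Qed.

(** The set [N n] collects the overlaps of the first [n.+1] terms of the two
sequences.  It misses [Z], so the sets [U n := V n `\` N n] are neighbourhoods of
[Z] like the [V n], but now [A m `&` U m] and [B n `&` U n] are always disjoint. *)
Lemma clopen_separates_sequences {T : topologicalType} (Z : set T)
    (V A B : nat -> set T) :
  clopen_filtration Z V -> shrinking_closures_clopen V ->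
  (forall n, clopen (A n)) -> (forall n, clopen (B n)) ->
  (forall m n, Z `&` (A m `&` B n) = set0) ->
  exists W, [/\ clopen W, Z `&` \bigcup_n A n `<=` W &
    Z `&` \bigcup_n B n `<=` ~` W].
Proof.
move=> [cV Vdecr VZ] sV cA cB AB0.
pose N n := \bigcup_(i < n.+1) A i `&` \bigcup_(i < n.+1) B i.
have cN n : clopen (N n) by apply: clopenI; exact: clopen_bigcup_fin.
have ZN n z : Z z -> ~ N n z.
  move=> Zz [[i _ Az] [j _ Bz]].
  by have : set0 z by rewrite -(AB0 i j).
pose U n := V n `\` N n.
have cAU n : clopen (A n `&` U n) by apply: clopenI => //; exact: clopen_setD.
have cBU n : clopen (B n `&` U n) by apply: clopenI => //; exact: clopen_setD.
have ZU n z : Z z -> U n z.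
  by move=> Zz; split; [move: Zz; rewrite -VZ; exact|exact: ZN].
exists (closure (\bigcup_n (A n `&` U n))); split.
- by apply: sV => // n x [_ []].
- by move=> z [Zz [n _ Az]]; apply: subset_closure; exists n => //; split; auto.
move=> z [Zz [n _ Bz]] Wz; suff : ~ (B n `&` U n) z by apply; split; auto.
move: z {Zz Bz} Wz; apply: closure_subW.
  by apply: open_closedC; case: (cBU n).
move=> x [m _ [Ax [_ nNm]]] [Bx [_ nNn]].
(* The overlap is recorded in [N] at the larger of the two indices. *)
have [mn|nm] := leqP m n.
  by apply: nNn; split; [exists m|exists n => /=].
by apply: nNm; split; [exists m => /=|exists n => //=; exact: ltnW].
Qed.

(** * The subspace *)

Lemma set_val_continuous {T : topologicalType} (Z : set T) :
  continuous (@set_val T Z).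
Proof. exact: initial_continuous. Qed.

Lemma nbhs_set_type_clopen {T : topologicalType} (Z : set T)
    (z : set_type Z) (A : set (set_type Z)) :
  zero_dimensional_space T -> nbhs z A ->
  exists C, [/\ clopen C, C (set_val z) & set_val @^-1` C `<=` A].
Proof.
move=> [_ [B [_ nbB] Bcl]] [_ [[U oU <-] Uz UA]].
have [|C [BC Cz] CU] := nbB (set_val z) U; first by exact: open_nbhs_nbhs.
by exists C; split => //; [exact: Bcl|move=> y /CU; exact: UA].
Qed.

Lemma set_type_compact {T : topologicalType} (Z : set T) :
  compact Z -> compact [set: set_type Z].
Proof.
move=> cZ F FF _.
have FZ : (set_val @ F) Z.
  by apply: (@filterS _ F _ setT) => [z _|]; [exact: set_valP|exact: filterT].
have [x [Zx xF]] := cZ (set_val @ F) _ FZ.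
exists (SigSub (mem_set Zx)); split => // A O FA [_ [[U oU <-] Ux UO]].
have [||_ [[z Az <-] Uz]] := xF (set_val @` A) U.
- by apply: (@filterS _ F _ A) => [z Az|]; [exists z|exact: FA].
- exact: open_nbhs_nbhs.
by exists z; split => //; exact: UO.
Qed.

Lemma set_type_zero_dimensional {T : topologicalType} (Z : set T) :
  zero_dimensional_space T -> zero_dimensional_space (set_type Z).
Proof.
move=> zT; have [hT _] := zT; split.
  move=> p q pq; apply/val_inj/hT => A B Ap Bq.
  have [z [Az Bz]] := pq (set_val @^-1` A) (set_val @^-1` B)
    (set_val_continuous Z p A Ap) (set_val_continuous Z q B Bq).
  by exists (set_val z).
exists [set set_val @^-1` C | C in clopen].
  split=> [_ [C [oC _] <-]|z A /(nbhs_set_type_clopen _ _ _ zT)].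
    by exists C.
  move=> [C [cC Cz CA]]; exists (set_val @^-1` C) => //.
  by split => //; exists C.
move=> _ [C cC <-]; apply: preimage_clopen => //; exact: set_val_continuous.
Qed.

(** The compact sets where [f] is at least [n.+1%:R^-1] exhaust the positivity
set, and each of them is separated by a clopen set of [T] from the compact set
where [f] is nonpositive. *)
Lemma positivity_set_clopens {R : realType} {T : topologicalType} (Z : set T)
    (f : set_type Z -> R) :
  compact [set: T] -> zero_dimensional_space T -> compact Z -> continuous f ->
  exists A : nat -> set T, (forall n, clopen (A n)) /\
    [set z | (0 < f z)%R] = set_val @^-1` \bigcup_n A n.
Proof.
move=> cT zT cZ cf.
have closed_image (D : set R) : closed D -> closed (set_val @` (f @^-1` D)).
  move=> cD; apply: compact_closed; first by case: zT.
  apply: continuous_compact.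
    by apply: continuous_subspaceT; exact: set_val_continuous.
  apply: (subclosed_compact _ (set_type_compact Z cZ)) => //.
  by apply: preimage_closed => // z _; exact: cf.
have A_ex n : exists C, [/\ clopen C,
    set_val @` (f @^-1` [set r | (n.+1%:R^-1 <= r)%R]) `<=` C &
    C `<=` ~` (set_val @` (f @^-1` [set r | (r <= 0)%R]))].
  apply: clopen_between => //.
  - by apply: closed_image; exact: closed_ge.
  - by apply: closed_openC; apply: closed_image; exact: closed_le.
  move=> _ [z /= nfz <-] [y /= fy /val_inj yz]; move: nfz; rewrite -yz.
  by apply/negP; rewrite -ltNge (le_lt_trans fy)// invr_gt0.
have [A AP] := choice A_ex.
exists A; split=> [n|]; first by case: (AP n).
apply/seteqP; split=> z /=.
  move=> fz; have [n] := ltr_add_invr fz; rewrite add0r => nfz.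
  by exists n => //; case: (AP n) => _ + _; apply; exists z => //=; exact: ltW.
move=> [n _ Az]; rewrite ltNge; apply/negP => fz.
by case: (AP n) => _ _ /(_ _ Az); apply; exists z.
Qed.

(** The transfer from clopen sets of [T] to the subspace [Z].  For the F-space
property, the continuous function that separates is the indicator of the
complement of a clopen set. *)
Lemma set_type_parovicenko {R : realType} {T : topologicalType} (Z : set T)
    (V : nat -> set T) :
  compact [set: T] -> zero_dimensional_space T -> clopen_filtration Z V ->
  Z° = set0 -> shrinking_closures_clopen V -> parovicenko R (set_type Z).
Proof.
move=> cT zT fV Z0 sV.
have cZ : compact Z.
  apply: (subclosed_compact _ cT) => //; case: fV => cV _ <-.
  by apply: closed_bigI => n _; case: (cV n).
have inZ z : Z z -> exists y : set_type Z, set_val y = z.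
  by move=> Zz; exists (SigSub (mem_set Zz)).
split.
- by split; [exact: set_type_compact|exact: set_type_zero_dimensional].
- apply/seteqP; split => // z [_ [A /(nbhs_set_type_clopen _ _ _ zT)]].
  move=> [C [cC Cz CA]]; rewrite setIT => Az.
  have C1 y : C (set_val y) -> y = z by move=> /CA; rewrite Az.
  have [|W [_]] := clopen_splits Z C V cT fV Z0 sV cC.
    by exists (set_val z); split => //; exact: set_valP.
  move=> [_ [/inZ[x <-] [/C1 -> Wz]]] [_ [/inZ[y <-] [/C1 -> ]]].
  by move=> /(_ Wz).
- move=> G [U oU ->] [p Up].
  have C_ex n : exists C, [/\ clopen C, C (set_val p) &
      set_val @^-1` C `<=` U n].
    apply: nbhs_set_type_clopen => //; apply: open_nbhs_nbhs.
    by split => //; exact: (Up n I).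
  have [C CP] := choice C_ex.
  have [n||W [cW [_ [/inZ[z <-] Wz]] WC]] :=
      clopen_inside_bigcap Z V C cT fV Z0 sV.
  + by case: (CP n).
  + exists (set_val p); split; first exact: set_valP.
    by move=> n _; case: (CP n).
  exists z; rewrite /interior /= nbhsE; exists (set_val @^-1` W).
    by split => //; exists W => //; case: cW.
  move=> y Wy n _; case: (CP n) => _ _; apply.
  by apply: (WC _ _ n I); split => //; exact: set_valP.
- move=> f cf.
  have [A [cA fA]] := positivity_set_clopens Z f cT zT cZ cf.
  have [|B [cB fB]] := positivity_set_clopens Z (fun z => - f z)%R cT zT cZ.
    by move=> z; exact: (cvgN (cf z)).
  have {}fB : [set z | (f z < 0)%R] = set_val @^-1` \bigcup_n B n.
    by rewrite -fB; apply/seteqP; split => z /=; rewrite oppr_gt0.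
  have [m n|W [cW AW BW]] := clopen_separates_sequences Z V A B fV sV cA cB.
    apply/seteqP; split => // _ [/inZ[z <-] [Az Bz]].
    have : [set z | (0 < f z)%R] z by rewrite fA; exists m.
    have : [set z | (f z < 0)%R] z by rewrite fB; exists n.
    by move=> /= /lt_trans h /h; rewrite ltxx.
  have cW' : clopen (set_val @^-1` W : set (set_type Z)).
    by apply: preimage_clopen => //; exact: set_val_continuous.
  exists (fun z => if z \in set_val @^-1` W then 0%R else 1%R); split.
  + exact: continuous_clopen_if.
  + by move=> _ [z _ <-]; case: ifP; rewrite /= in_itv/= ?lexx ?ler01.
  + rewrite fA => _ [z Az <-]; rewrite mem_set//.
    by apply: AW; split => //; exact: set_valP.
  + rewrite fB => _ [z Bz <-]; rewrite memNset//.
    by apply: BW; split => //; exact: set_valP.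
Qed.

(* [set_type Z] is the subtype of points of [Z], with the subspace topology. *)
Theorem proposition3p10 (R : realType) (X bX : topologicalType) (e : X -> bX)
    (Z : set bX) :
  zero_dimensional_space X -> banaschewski e ->
  zero_set R Z -> Z `&` range e = set0 ->
  parovicenko R (set_type Z).
Proof.
move=> _ be zZ Ze0; have [cbX zbX _ dense_e _] := be.
have [V fV] := zero_set_clopen_filtration Z cbX zbX zZ.
apply: (set_type_parovicenko Z V cbX zbX fV).
  apply: contrapT => /eqP/set0P Zn0.
  have [x [/interior_subset Zx ex]] := dense_e _ Zn0 (open_interior Z).
  by have : set0 x by rewrite -Ze0.
exact: banaschewski_shrinking_closures be Ze0 fV.
Qed.
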